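(* Let $p$ be an even positive integer and $\tau$ a non-negative integer. Let $\mu=\frac{p^2}{4}+2p+2$, $\gamma=2\mu-\left(\frac p2+4\right)$, $m=\mu+\tau\frac p2$, $g=\gamma+\tau(p-1)$, $c=p\mu+\tau\left(\frac{p^2}{2}-1\right)$, $S(p,\tau)=\langle m,g,g+1\rangle_c$ and $S(p)=S(p,0)$. Then $$\mathrm{E}(S(p,\tau))=\mathrm{E}(S(p))+\rho(S(p,\tau))=\frac p4\left(1-\frac p2\right)+\tau.$$
   Context: A numerical semigroup is a submonoid of $(\mathbb N,+)$ with finite complement. For integers $a_1,\dots,a_r$ and $t$, $\langle a_1,\dots,a_r\rangle_t$ denotes the smallest numerical semigroup containing $a_1,\dots,a_r$ and all integers $\ge t$. For a numerical semigroup $S$: conductor $c(S)$ is the smallest integer such that all integers $\ge c(S)$ are in $S$; multiplicity $m(S)$ is its least positive element; $L=\{s\in S: s<c(S)\}$; $P$ is the set of minimal generators; $q=\lceil c(S)/m(S)\rceil$; $\rho(S)=q\,m(S)-c(S)$; $I_q=\{z\in\mathbb Z: c(S)\le z<c(S)+m(S)\}$; $D_q=I_q\setminus P$. The Eliahou number is $\mathrm{E}(S)=|P\cap L|\,|L|-q\,|D_q|+\rho(S)$. *)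

(* Defs.v *)
From mathcomp Require Export all_boot all_order all_algebra finmap.
From mathcomp Require Export boolp classical_sets functions cardinality.

Set Implicit Arguments.
Unset Strict Implicit.
Unset Printing Implicit Defensive.

Import Order.TTheory GRing.Theory Num.Theory.

Local Open Scope classical_set_scope.

Definition is_submonoid (S : set nat) : Prop :=
  S 0 /\ forall x y, S x -> S y -> S (x + y).

Definition is_numerical_semigroup (S : set nat) : Prop :=
  is_submonoid S /\ finite_set (~` S).

(* The semigroup <a_1, ..., a_r>_t, for a = [:: a_1; ...; a_r]. *)
Definition numsgp_gen (a : seq nat) (t : nat) : set nat :=
  smallest is_numerical_semigroup ([set` a] `|` [set x | t <= x]).

(* 0 when A is empty, which does not happen for the sets used below. *)
Definition least (A : set nat) : nat :=
  xget 0 [set x | A x /\ forall y, A y -> x <= y].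

(* Since negative integers are never in S, the least such integer is a natural
   number, also for S = setT. *)
Definition conductor (S : set nat) : nat :=
  least [set c | forall z, c <= z -> S z].

Definition multiplicity (S : set nat) : nat := least [set x | S x /\ 0 < x].

Definition left_part (S : set nat) : set nat :=
  [set s | S s /\ s < conductor S].

Definition generates (A S : set nat) : Prop := smallest is_submonoid A = S.

Definition is_minimal_generating_set (S A : set nat) : Prop :=
  generates A S /\ forall B, B `<=` A -> generates B S -> B = A.

(* A numerical semigroup has exactly one minimal generating set, so this union
   is that set. *)
Definition minimal_generators (S : set nat) : set nat :=
  \bigcup_(A in is_minimal_generating_set S) A.

Definition qnum (S : set nat) : int :=
  Num.ceil ((conductor S)%:R / (multiplicity S)%:R : rat)%R.

Definition rho (S : set nat) : int :=
  (qnum S * (multiplicity S)%:Z - (conductor S)%:Z)%R.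

Definition Iq (S : set nat) : set nat :=
  [set z | conductor S <= z < conductor S + multiplicity S].

Definition Dq (S : set nat) : set nat := Iq S `\` minimal_generators S.

(* Cardinality of a finite set (0 for an infinite one); the sets L and I_q, to
   whose subsets it is applied, are finite. *)
Definition card (A : set nat) : nat := #|` fset_set A|.

Definition Eliahou (S : set nat) : int :=
  ((card (minimal_generators S `&` left_part S))%:Z * (card (left_part S))%:Z
   - qnum S * (card (Dq S))%:Z + rho S)%R.

(* For p even and positive, all divisions below are exact and no subtraction
   truncates. *)
Definition mu (p : nat) : nat := p ^ 2 %/ 4 + 2 * p + 2.
Definition gamma (p : nat) : nat := 2 * mu p - (p %/ 2 + 4).
Definition mparam (p tau : nat) : nat := mu p + tau * (p %/ 2).
Definition gparam (p tau : nat) : nat := gamma p + tau * (p - 1).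
Definition cparam (p tau : nat) : nat := p * mu p + tau * (p ^ 2 %/ 2 - 1).

Definition Sptau (p tau : nat) : set nat :=
  numsgp_gen [:: mparam p tau; gparam p tau; (gparam p tau).+1] (cparam p tau).

Definition Sp (p : nat) : set nat := Sptau p 0.

(* Main.v *)
(* Write p = 2k, t = tau and d = k + 4 + t. Then m = k d + 2, g = 2m - d and
   c = 2k m - t, so that q = 2k and rho = t. Every element of <m, g, g+1> has
   the form n m - b d + j with j <= b <= n/2. For b <= k it lies in
   ](n-1)m, nm], and the blocks {n m - b d + j | j <= b} are disjoint, so L
   consists of the blocks of level n < 2k and those of level 2k with b >= 1.
   Likewise D_q = I_q \cap <m, g, g+1> consists of 2k m, the blocks of level
   2k+1 with 1 <= b <= k, and the block of level 2k+2 with b = k+1. Hence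
   |L| = k(k+1)(k+2)/3 + k(k+3)/2 and |D_q| = (k+2)(k+3)/2, while P \cap L
   = {m, g, g+1}. *)

Require Import Defs.
From mathcomp Require Import zify ring lra.
Import Order.TTheory GRing.Theory Num.Theory.
Set Implicit Arguments.
Unset Strict Implicit.
Unset Printing Implicit Defensive.

Local Open Scope classical_set_scope.

(** * Least elements and cardinalities *)

Lemma least_eq (A : set nat) n :
  A n -> (forall y, A y -> n <= y) -> least A = n.
Proof.
move=> An minn; apply: xget_subset1 => // x y [Ax xle] [Ay yle].
by apply/eqP; rewrite eqn_leq xle ?yle.
Qed.

Lemma card_set_seq (s : seq nat) : uniq s -> card [set` s] = size s.
Proof.
move=> s_uniq; rewrite /card.
have -> : [set` s] = [set` [fset x in s]%fset].
  by apply/seteqP; split=> x /=; rewrite !inE.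
by rewrite set_fsetK card_fseq undup_id.
Qed.

(** * Minimal generators as irreducible elements *)

Definition irreducibles (S : set nat) : set nat :=
  [set x | [/\ S x, 0 < x
    & forall y z, S y -> S z -> 0 < y -> 0 < z -> x <> y + z]].

Lemma smallest_submonoid (A : set nat) : is_submonoid (smallest is_submonoid A).
Proof.
split=> [B [[B0 _] _] //|x y Ax Ay B BA]; move: (BA) => [[_ BD] _].
by apply: BD; [apply: Ax|apply: Ay].
Qed.

Lemma irreducibles_generate (S : set nat) :
  is_submonoid S -> generates (irreducibles S) S.
Proof.
move=> Ssub; apply/seteqP; split; first by apply: smallest_sub => // x [].
move=> x; have [n] := ubnP x; elim: n x => // n IHn x lexn Sx.
have [->|x_gt0] := posnP x; first by case: (smallest_submonoid (irreducibles S)).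
have [irr|red] := pselect (irreducibles S x); first exact: sub_gen_smallest.
have [y [z [Sy Sz y0 z0 xE]]] :
    exists y z, [/\ S y, S z, 0 < y, 0 < z & x = y + z].
  apply: contrapT => nyz; apply: red; split=> // y z Sy Sz y0 z0 xE.
  by apply: nyz; exists y, z.
by rewrite xE; apply: (smallest_submonoid _).2; apply: IHn => //; lia.
Qed.

(** If an irreducible [x] were missing from [A], then [S] without [x] would be a submonoid
    containing [A], hence all of [S]. *)
Lemma irreducibles_sub_generators (A S : set nat) :
  is_submonoid S -> generates A S -> irreducibles S `<=` A.
Proof.
move=> [S0 SD] genA x [Sx x_gt0 irr]; apply: contrapT => nAx.
have AS : A `<=` S by rewrite -genA; apply: sub_gen_smallest.
suff: S `<=` S `\ x by move=> /(_ x Sx) [_]; apply.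
rewrite -{1}genA; apply: smallest_sub; last first.
  by move=> y Ay; split; [exact: AS|move=> /= yx; apply: nAx; rewrite -yx].
split=> [|y z [Sy yx] [Sz zx]]; first by split=> //= x0; rewrite -x0 in x_gt0.
split; first exact: SD.
have [->//|y0] := posnP y; have [->|z0] := posnP z; first by rewrite addn0.
by move=> /= /esym; exact: irr.
Qed.

Lemma minimal_generatorsE (S : set nat) :
  is_submonoid S -> minimal_generators S = irreducibles S.
Proof.
move=> Ssub; have gen := irreducibles_generate Ssub.
apply/seteqP; split=> [x [A [genA minA] Ax]|x irrx].
  by rewrite (minA _ (irreducibles_sub_generators Ssub genA) gen).
exists (irreducibles S) => //; split=> // B BI genB.
by apply/seteqP; split=> //; exact: irreducibles_sub_generators.
Qed.

(** * The semigroup generated by m, g, g+1 *)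

(** Here [b] counts the summands g and g+1 together, and [j] of them are g+1. *)
Definition span3 (m g : nat) : set nat :=
  [set x | exists a b j, j <= b /\ x = a * m + b * g + j].

Lemma span3_submonoid (m g : nat) : is_submonoid (span3 m g).
Proof.
split; first by exists 0, 0, 0.
move=> _ _ [a [b [j [jb ->]]]] [a' [b' [j' [jb' ->]]]].
by exists (a + a'), (b + b'), (j + j'); split; [lia|ring].
Qed.

Lemma span3_cases (m g x : nat) : 0 < m -> 0 < g -> span3 m g x ->
  [\/ x = 0, x \in [:: m; g; g.+1]
    | exists y z, [/\ span3 m g y, span3 m g z, 0 < y, 0 < z & x = y + z]].
Proof.
move=> m0 g0 [[|a] [[|b] [j [jb ->]]]].
- by apply: Or31; lia.
- case: b jb => [|b] jb.
    apply: Or32; rewrite !inE; lia.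
  (* Split off g+1 when all summands are g+1, and g otherwise, so that the remaining [j] is at most
     [b.+1]. *)
  apply: Or33; exists (g + (j == b.+2)), (b.+1 * g + (j - (j == b.+2))).
  split; try nia.
    by exists 0, 1, (j == b.+2); split; lia.
  by exists 0, b.+1, (j - (j == b.+2)); split; lia.
- case: a => [|a]; first by apply: Or32; rewrite !inE; lia.
  apply: Or33; exists m, (a.+1 * m); split; try nia.
    by exists 1, 0, 0; split; lia.
  by exists a.+1, 0, 0; split; lia.
- apply: Or33; exists m, (a * m + b.+1 * g + j); split; try nia.
    by exists 1, 0, 0; split; lia.
  by exists a, b.+1, j.
Qed.

Lemma numsgp_genE (m g c : nat) :
  numsgp_gen [:: m; g; g.+1] c = span3 m g `|` [set x | c <= x].
Proof.
apply/seteqP; split.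
  apply: smallest_sub; last first.
    move=> x [|cx]; last by right.
    rewrite /= !inE => /or3P[]/eqP->; left.
    - by exists 1, 0, 0; split; lia.
    - by exists 0, 1, 0; split; lia.
    - by exists 0, 1, 1; split; lia.
  have [S0 SD] := span3_submonoid m g.
  split; first split; first by left.
    move=> x y [Mx|cx] [My|cy]; [by left; apply: SD|right..] => /=.
    - by apply: leq_trans cy _; rewrite leq_addl.
    - by apply: leq_trans cx _; rewrite leq_addr.
    - by apply: leq_trans cx _; rewrite leq_addr.
  apply: (sub_finite_set _ (finite_II c)) => x /= nx.
  by rewrite ltnNge; apply/negP => cx; apply: nx; right.
move=> x Sx B [[[B0 BD] _] sub].
case: Sx => [|cx]; last by apply: sub; right.
have BM y n : B y -> B (n * y).
  by move=> By; elim: n => // n IHn; rewrite mulSn; exact: BD.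
move=> [a [b [j [jb ->]]]].
have -> : a * m + b * g + j = a * m + (b - j) * g + j * g.+1 by nia.
by apply: (BD); first apply: (BD); apply: BM; apply: sub; left;
  rewrite /= !inE eqxx ?orbT.
Qed.

(** * Levels and the intervals they occupy *)

(* [x] has level [n] = a + 2b when x = a m + b g + j with g = 2m - d, that is,
   x = n m - b d + j. *)
Definition at_level (m d n b j x : nat) : Prop :=
  [/\ b.*2 <= n, j <= b & x + b * d = n * m + j].

Lemma span3_level (m d x : nat) : d <= m ->
  span3 m (m.*2 - d) x <-> exists n b j, at_level m d n b j x.
Proof.
move=> dm; split=> [[a [b [j [jb ->]]]]|[n [b [j [bn jb xE]]]]].
  by exists (a + b.*2), b, j; split; nia.
exists (n - b.*2), b, j; split=> //.
have : b * d <= b * m by rewrite leq_mul2l dm orbT.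
nia.
Qed.

(** The lower bound comes from b d <= k d = m - 2, the upper one from j <= b. *)
Lemma level_bounds (k d m n b j x : nat) : m = k * d + 2 -> b <= k ->
  0 < d -> at_level m d n b j x -> n * m + 2 <= x + m /\ x + b * d.-1 <= n * m.
Proof.
move=> mE bk d0 [bn jb xE].
have : b * d <= k * d by rewrite leq_mul2r bk orbT.
have : b * d = b * d.-1 + b by nia.
by move=> ? ?; split; lia.
Qed.

(* The first inequality says b (2m - d) <= x. *)
Lemma high_level (k d m n b j x i : nat) : m = k * d + 2 -> i <= b ->
  d <= m -> at_level m d n b j x -> i * m.*2 <= x + i * d.
Proof.
move=> mE ib dm [bn jb xE].
have : b.*2 * m <= n * m by rewrite leq_mul2r bn orbT.
have : (b - i) * d <= (b - i) * m by rewrite leq_mul2l dm orbT.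
nia.
Qed.

(** As x lies in ](n-1)m, nm], it determines n; then b d - j with 0 <= j < d determines b and j. The
    bounds on [j] are weaker than [j <= b] because the block b = 1 of [Dq_index] has j up to k+3. *)
Lemma level_inj (k d m n b j n' b' j' x : nat) : m = k * d + 2 ->
  b <= k -> b' <= k -> j < d -> j' < d -> j <= b * d -> j' <= b' * d ->
  x + b * d = n * m + j -> x + b' * d = n' * m + j' -> (n, (b, j)) = (n', (b', j')).
Proof.
move=> mE bk bk' jd jd' jb jb' xE xE'.
have bdk : b * d <= k * d by rewrite leq_mul2r bk orbT.
have bdk' : b' * d <= k * d by rewrite leq_mul2r bk' orbT.
have nn : n = n'.
  have [lt|lt|//] := ltngtP n n'.
    have : n.+1 * m <= n' * m by rewrite leq_mul2r lt orbT.
    by lia.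
  have : n'.+1 * m <= n * m by rewrite leq_mul2r lt orbT.
  by lia.
subst n'; have bb : b = b'.
  have [lt|lt|//] := ltngtP b b'.
    have : b.+1 * d <= b' * d by rewrite leq_mul2r lt orbT.
    by lia.
  have : b'.+1 * d <= b * d by rewrite leq_mul2r lt orbT.
  by lia.
by subst b'; congr (_, (_, _)); lia.
Qed.

(** * Index sets for L and D_q, and their sizes *)

Definition triangle (lo n : nat) : seq (nat * nat) :=
  [seq (b, j) | b <- iota lo n, j <- iota 0 b.+1].

Lemma triangleP (lo n b j : nat) :
  ((b, j) \in triangle lo n) = (lo <= b < lo + n) && (j <= b).
Proof.
apply/allpairsPdep/andP => [[b' [j' [+ + [-> ->]]]]|[bn jb]].
  by rewrite !mem_iota.
by exists b, j; rewrite !mem_iota.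
Qed.

Lemma triangle_uniq (lo n : nat) : uniq (triangle lo n).
Proof.
apply: allpairs_uniq_dep => [|b _|]; rewrite ?iota_uniq //.
by move=> [b j] [b' j'] _ _ /= [-> ->].
Qed.

Lemma size_triangle (lo n : nat) :
  2 * size (triangle lo n) = n * (lo.*2 + n.+1).
Proof.
rewrite size_allpairs_dep; elim: n lo => // n IHn lo /=.
by rewrite size_iota mulnDr IHn; nia.
Qed.

Definition level_value (m d : nat) (i : nat * (nat * nat)) : nat :=
  i.1 * m + i.2.2 - i.2.1 * d.

(** At level 2k, b = 0 is left out: it gives 2km, which is at least c. *)
Definition left_index (k : nat) : seq (nat * (nat * nat)) :=
  [seq (n, bj) | n <- iota 0 k.*2, bj <- triangle 0 n./2.+1]
  ++ [seq (k.*2, bj) | bj <- triangle 1 k].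

(* The two intervals of levels 2k+1 (b = 1) and 2k+2 (b = k+1) are adjacent;
   the second summand lists their union as a single one. *)
Definition Dq_index (k : nat) : seq (nat * (nat * nat)) :=
  (k.*2, (0, 0)) :: [seq (k.*2.+1, (1, j)) | j <- iota 0 (k + 4)]
  ++ [seq (k.*2.+1, bj) | bj <- triangle 2 k.-1].

Lemma left_indexP (k n b j : nat) : ((n, (b, j)) \in left_index k) =
  [&& j <= b, b.*2 <= n & (n < k.*2) || (n == k.*2) && (0 < b)].
Proof.
rewrite mem_cat.
have -> : ((n, (b, j)) \in [seq (n, bj) | n <- iota 0 k.*2, bj <- triangle 0 n./2.+1])
    = [&& n < k.*2, b.*2 <= n & j <= b].
  apply/allpairsPdep/and3P => [[n' [[b' j'] [+ + [-> -> ->]]]]|[nk bn jb]].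
    rewrite triangleP mem_iota => ? ?; split; lia.
  by exists n, (b, j); rewrite triangleP mem_iota; split=> //; lia.
have -> : ((n, (b, j)) \in [seq (k.*2, bj) | bj <- triangle 1 k])
    = [&& n == k.*2, 0 < b, b <= k & j <= b].
  apply/mapP/and4P => [[[b' j'] + [-> -> ->]]|[/eqP nk b0 bk jb]].
    by rewrite triangleP => ?; split; lia.
  by exists (b, j); rewrite ?nk // triangleP; lia.
by lia.
Qed.

Lemma Dq_indexP (k n b j : nat) : 0 < k -> ((n, (b, j)) \in Dq_index k) =
  [|| [&& n == k.*2, b == 0 & j == 0]
    , [&& n == k.*2.+1, b == 1 & j < k + 4]
    | [&& n == k.*2.+1, 1 < b, b <= k & j <= b]].
Proof.
move=> k0; rewrite inE mem_cat.
have -> : ((n, (b, j)) \in [seq (k.*2.+1, (1, j)) | j <- iota 0 (k + 4)])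
    = [&& n == k.*2.+1, b == 1 & j < k + 4].
  apply/mapP/and3P => [[j' + [-> -> ->]]|[/eqP-> /eqP-> jk]].
    by rewrite mem_iota.
  by exists j => //; rewrite mem_iota.
have -> : ((n, (b, j)) \in [seq (k.*2.+1, bj) | bj <- triangle 2 k.-1])
    = [&& n == k.*2.+1, 1 < b, b <= k & j <= b].
  apply/mapP/and4P => [[[b' j'] + [-> -> ->]]|[/eqP nk b0 bk jb]].
    by rewrite triangleP => ?; split; lia.
  by exists (b, j); rewrite ?nk // triangleP; lia.
by rewrite !xpair_eqE.
Qed.

Lemma left_index_uniq (k : nat) : uniq (left_index k).
Proof.
rewrite cat_uniq map_inj_uniq ?triangle_uniq; last by move=> ? ? [].
rewrite allpairs_uniq_dep ?iota_uniq //; last 2 first.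
- by move=> n _; exact: triangle_uniq.
- by move=> [n bj] [n' bj'] _ _ /= [-> ->].
rewrite andbT andTb; apply/hasPn => _ /mapP[bj _ ->].
apply/negP => /allpairsPdep[n [bj' [+ _ [nE _]]]].
by rewrite mem_iota -nE; lia.
Qed.

Lemma Dq_index_uniq (k : nat) : uniq (Dq_index k).
Proof.
rewrite /Dq_index cons_uniq mem_cat cat_uniq.
rewrite !map_inj_uniq ?triangle_uniq ?iota_uniq; try by move=> ? ? [].
rewrite /= andbT; apply/andP; split.
  apply/negP => /orP[] /mapP[? _]; case; lia.
apply/hasPn => _ /mapP[[b j] + ->]; rewrite triangleP => b_gt1.
by apply/negP => /mapP[j' _ [b1 _]]; lia.
Qed.

Lemma size_left_index (k : nat) :
  6 * size (left_index k) = 2 * (k * k.+1 * k.+2) + 3 * (k * (k + 3)).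
Proof.
rewrite size_cat size_map size_allpairs_dep mulnDr.
have -> : 6 * size (triangle 1 k) = 3 * (k * (k + 3)).
  by have := size_triangle 1 k; lia.
congr (_ + _).
set T := fun n => size (triangle 0 n./2.+1).
have TE n : 2 * T n = n./2.+1 * n./2.+2 by rewrite size_triangle.
elim: k => // k IHk.
(* Passing from k to k+1 adds the levels 2k and 2k+1; both allow b <= k, so each has (k+1)(k+2)/2
   pairs. *)
rewrite doubleS -[k.*2.+2]addn2 iotaD map_cat sumn_cat mulnDr IHk /=.
have := TE k.*2; have := TE k.*2.+1; rewrite /= uphalf_double doubleK add0n.
move: (T _) (T _) => x y yE xE; nia.
Qed.

Lemma size_Dq_index (k : nat) :
  0 < k -> 2 * size (Dq_index k) = (k + 2) * (k + 3).
Proof.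
move=> k0; rewrite /= size_cat !size_map size_iota.
by have := size_triangle 2 k.-1; nia.
Qed.

(** The hypothesis keeps the subtraction in [level_value] from truncating. *)
Lemma level_value_at (m d n b j x : nat) : b * d <= n * m + j ->
  (x == level_value m d (n, (b, j))) = (x + b * d == n * m + j).
Proof. by rewrite /level_value /=; lia. Qed.

Lemma at_levelE (m d n b j : nat) : d <= m -> b.*2 <= n -> j <= b ->
  at_level m d n b j (level_value m d (n, (b, j))).
Proof.
move=> dm bn jb; split=> //; apply/eqP; rewrite -level_value_at //.
have : b * d <= b * m by rewrite leq_mul2l dm orbT.
have : b.*2 * m <= n * m by rewrite leq_mul2r bn orbT.
nia.
Qed.

(** * The elements of L and D_q as values of the indices *)

Lemma gap_lt (k d m : nat) : 0 < k -> m = k * d + 2 -> d < m.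
Proof. by nia. Qed.

Lemma left_part_index (k t d m x : nat) :
    0 < k -> d = k + 4 + t -> m = k * d + 2 ->
  span3 m (m.*2 - d) x /\ x < k.*2 * m - t <->
  x \in [seq level_value m d i | i <- left_index k].
Proof.
move=> k0 dE mE; have dm := gap_lt k0 mE; have d0 : 0 < d by lia.
rewrite span3_level; last exact: ltnW.
split=> [[[n [b [j lev]]] xc]|/mapP[[n [b j]] + ->]].
  have [bn jb xE] := lev; apply/mapP; exists (n, (b, j)); last first.
    by apply/eqP; rewrite level_value_at; lia.
  have [bk|kb] := leqP b k; last first.
    (* For b > k, x is at least (k+1)(2m-d) = 2km + (m+2-d) > 2km. *)
    by have := high_level mE kb (ltnW dm) lev; nia.
  have [lo _] := level_bounds mE bk d0 lev.
  have nk : n < k.*2.+1.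
    rewrite -(ltn_pmul2r (leq_ltn_trans (leq0n d) dm)).
    nia.
  rewrite left_indexP jb bn /=; have [//|nk'] := ltnP n k.*2.
  have nE : n = k.*2 by lia.
  by rewrite nE eqxx lt0n; apply/eqP => b0; subst b n; lia.
rewrite left_indexP => /and3P[jb bn nb].
have lev := at_levelE (ltnW dm) bn jb.
move: (level_value m d _) lev => y lev; split; first by exists n, b, j.
have bk : b <= k by lia.
have [_ hi] := level_bounds mE bk d0 lev.
case/orP: nb => [nk|/andP[/eqP nk b0]].
  (* Below level 2k, x <= (2k-1)m < 2km - t since t < m. *)
  have : n.+1 * m <= k.*2 * m by rewrite leq_mul2r nk orbT.
  by lia.
(* At level 2k with b >= 1, x <= 2km - (d-1), and d - 1 > t. *)
have : 1 * d.-1 <= b * d.-1 by rewrite leq_mul2r b0 orbT.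
by rewrite -nk; lia.
Qed.

Lemma Dq_part_index (k t d m x : nat) :
    0 < k -> d = k + 4 + t -> m = k * d + 2 ->
  span3 m (m.*2 - d) x /\ k.*2 * m - t <= x < k.*2 * m - t + m <->
  x \in [seq level_value m d i | i <- Dq_index k].
Proof.
move=> k0 dE mE; have dm := gap_lt k0 mE; have d0 : 0 < d by lia.
have m0 : 0 < m by lia.
have tm : t < k.*2 * m by nia.
rewrite span3_level; last exact: ltnW.
split=> [[[n [b [j lev]]] /andP[cx xc]]|/mapP[[n [b j]] + ->]].
  have [bn jb xE] := lev; apply/mapP.
  have [bk|kb] := leqP b k; last first.
    have hi := high_level mE kb (ltnW dm) lev.
    have nE : n = k.*2.+2.
      apply/eqP; rewrite eqn_leq; apply/andP; split; last by lia.
      rewrite -ltnS -(ltn_pmul2r m0).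
      (* For b >= k+2, x is at least (k+2)(2m-d) = 2km + m + 2(m-d) + 2, beyond I_q. *)
      have [bk1|kb1] := leqP b k.+1; last first.
        by have := high_level mE kb1 (ltnW dm) lev; nia.
      have : b = k.+1 by lia.
      by move=> bE; subst b; nia.
    have bE : b = k.+1 by lia.
    (* Since m = kd + 2, (2k+2)m - (k+1)d + j = (2k+1)m - d + (j+2): the block with b = k+1
       continues the one with b = 1. *)
    subst n b; exists (k.*2.+1, (1, j.+2)).
      by rewrite Dq_indexP // eqxx /=; lia.
    by apply/eqP; rewrite level_value_at; nia.
  have [lo up] := level_bounds mE bk d0 lev.
  exists (n, (b, j)); last by apply/eqP; rewrite level_value_at; lia.
  have nk1 : n < k.*2.+2 by rewrite -(ltn_pmul2r m0); lia.
  have nk2 : k.*2 <= n by rewrite -ltnS -(ltn_pmul2r m0); nia.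
  rewrite Dq_indexP //; have [nE|nE] : n = k.*2 \/ n = k.*2.+1 by lia.
    have : b = 0.
      have [//|b0] := posnP b; subst n.
      have : 1 * d.-1 <= b * d.-1 by rewrite leq_mul2r b0 orbT.
      by lia.
    by lia.
  (* At level 2k+1, b = 0 gives (2k+1)m, which is at least c + m. *)
  have : b != 0 by apply/eqP => b0; subst b n; nia.
  by lia.
rewrite Dq_indexP // => /or3P[/and3P[/eqP-> /eqP-> /eqP->]
  |/and3P[/eqP-> /eqP-> jk]|/and4P[/eqP-> b1 bk jb]].
- rewrite /level_value /= mul0n addn0 subn0; split; last by lia.
  by exists k.*2, 0, 0; split; lia.
- split; last by rewrite /level_value /=; nia.
  (* Only j <= 1 is allowed for b = 1; larger j come from level 2k+2. *)
  have [j1|j1] := leqP j 1.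
    by exists k.*2.+1, 1, j; apply: at_levelE; lia.
  exists k.*2.+2, k.+1, (j - 2); split; [lia..|].
  by rewrite /level_value /=; nia.
- have bn : b.*2 <= k.*2.+1 by lia.
  have lev := at_levelE (ltnW dm) bn jb.
  move: (level_value m d _) lev => y lev; split.
    by exists k.*2.+1, b, j.
  have [lo hi] := level_bounds mE bk d0 lev.
  have : 1 * d.-1 <= b * d.-1 by rewrite leq_mul2r (ltnW b1) orbT.
  by lia.
Qed.

Lemma level_value_inj (k d m : nat) (s : seq (nat * (nat * nat))) :
    m = k * d + 2 ->
  (forall n b j, (n, (b, j)) \in s ->
     [/\ b <= k, j < d, j <= b * d & b * d <= n * m]) ->
  {in s &, injective (level_value m d)}.
Proof.
move=> mE sP [n [b j]] [n' [b' j']] /sP[bk jd jb bn] /sP[bk' jd' jb' bn'] eqv.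
apply: (level_inj (x := level_value m d (n, (b, j))) mE bk bk' jd jd' jb jb').
  by apply/eqP; rewrite -level_value_at ?eqxx //; lia.
by apply/eqP; rewrite -level_value_at ?eqv //; lia.
Qed.

Lemma left_values_uniq (k t d m : nat) : 0 < k -> d = k + 4 + t ->
  m = k * d + 2 -> uniq [seq level_value m d i | i <- left_index k].
Proof.
move=> k0 dE mE; rewrite map_inj_in_uniq ?left_index_uniq //.
apply: (level_value_inj mE) => n b j; rewrite left_indexP => /and3P[jb bn nb].
have dm := gap_lt k0 mE.
have bm : b * d <= b * m by rewrite leq_mul2l (ltnW dm) orbT.
have nm : b.*2 * m <= n * m by rewrite leq_mul2r bn orbT.
by split; nia.
Qed.

(** The bound [j < d] of [level_value_inj] is tight here: for t = 0 the largest j is k+3 = d-1. *)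
Lemma Dq_values_uniq (k t d m : nat) : 0 < k -> d = k + 4 + t ->
  m = k * d + 2 -> uniq [seq level_value m d i | i <- Dq_index k].
Proof.
move=> k0 dE mE; rewrite map_inj_in_uniq ?Dq_index_uniq //.
apply: (level_value_inj mE) => n b j; rewrite Dq_indexP // => nb.
have dm := gap_lt k0 mE.
have bm : b * d <= b * m by rewrite leq_mul2l (ltnW dm) orbT.
have bn : b.*2 <= n by lia.
have nm : b.*2 * m <= n * m by rewrite leq_mul2r bn orbT.
by split; nia.
Qed.

(** * The parameters in terms of k, d and t *)

(** For p = 2k, mu = k(k+4) + 2; adding the multiples of t yields m = kd + 2, g = 2m - d and c = 2km
    - t. *)
Lemma SptauE (k t d m : nat) : 0 < k -> d = k + 4 + t -> m = k * d + 2 ->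
  Sptau k.*2 t = span3 m (m.*2 - d) `|` [set x | k.*2 * m - t <= x].
Proof.
move=> k0 dE mE; have dm := gap_lt k0 mE.
have k2 : k.*2 %/ 2 = k by rewrite divn2 doubleK.
have k4 : k.*2 ^ 2 %/ 4 = k ^ 2 by rewrite -muln2 expnMn mulnK.
have k24 : k.*2 ^ 2 %/ 2 = 2 * k ^ 2.
  by rewrite -muln2 expnMn (_ : 2 ^ 2 = 2 * 2) // mulnA mulnK // mulnC.
have muE : mu k.*2 = k ^ 2 + 4 * k + 2 by rewrite /mu k4; lia.
have mpE : mparam k.*2 t = m by rewrite /mparam muE k2; nia.
have gpE : gparam k.*2 t = m.*2 - d by rewrite /gparam /gamma muE k2; nia.
have cpE : cparam k.*2 t = k.*2 * m - t by rewrite /cparam muE k24; nia.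
by rewrite /Sptau mpE gpE cpE numsgp_genE.
Qed.

(** * The invariants of S(2k, t) *)

Section Invariants.
Variables (k t d m : nat).
Hypotheses (k_gt0 : 0 < k) (dE : d = k + 4 + t) (mE : m = k * d + 2).

Let c := k.*2 * m - t.
Let S := span3 m (m.*2 - d) `|` [set x | c <= x].

Let d_lt_m : d < m. Proof. exact: gap_lt k_gt0 mE. Qed.

Let c_gt : (m.*2 - d).+1 < c. Proof. by rewrite /c; nia. Qed.

Lemma S_submonoid : is_submonoid S.
Proof.
rewrite /S -numsgp_genE; split=> [B [[[B0 _] _] _] //|x y Sx Sy B BA].
by move: (BA) => [[[_ BD] _] _]; apply: BD; [exact: Sx|exact: Sy].
Qed.

Lemma conductorE : conductor S = c.
Proof.
apply: least_eq => [z cz|y Sy]; first by right.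
rewrite leqNgt; apply/negP => yc.
(* It suffices that c-1 is a gap: elements of the span below c are at most (2k-1)m or at most 2km -
   (d-1) = c - (k+3), and both bounds are below c-1. *)
have := Sy c.-1 ltac:(lia); case=> [|/=]; last by lia.
rewrite span3_level ?(ltnW d_lt_m)// => -[n [b [j lev]]].
have : c.-1 \in [seq level_value m d i | i <- left_index k].
  rewrite -(left_part_index c.-1 k_gt0 dE mE) span3_level ?(ltnW d_lt_m)//.
  by split; [exists n, b, j|rewrite -/c; lia].
case/mapP => [[n' [b' j']]]; rewrite left_indexP => /and3P[jb bn nb] cE.
have := at_levelE (ltnW d_lt_m) bn jb; rewrite -cE => {}lev.
have bk : b' <= k by lia.
have [_ hi] := level_bounds mE bk ltac:(lia) lev.
case/orP: nb => [nk|/andP[/eqP nk b0]].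
  have : n'.+1 * m <= k.*2 * m by rewrite leq_mul2r nk orbT.
  by move: yc; rewrite /c; lia.
have : 1 * d.-1 <= b' * d.-1 by rewrite leq_mul2r b0 orbT.
by move: hi; rewrite nk /c; lia.
Qed.

Lemma span3_ge (x : nat) : span3 m (m.*2 - d) x -> 0 < x -> m <= x.
Proof. by move=> [[|a] [[|b] [j [jb ->]]]]; nia. Qed.

Lemma multiplicityE : multiplicity S = m.
Proof.
apply: least_eq => [|y [[Sy y0|/= cy y0]]]; last by lia.
  by split; [left; exists 1, 0, 0; lia|lia].
exact: span3_ge.
Qed.

(** All three lie in [m, 2m[, whereas a sum of two positive elements of S is at least 2m. *)
Lemma generators_irreducible (x : nat) :
  x \in [:: m; m.*2 - d; (m.*2 - d).+1] -> irreducibles S x.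
Proof.
move=> xP; have xm : x < m.*2 by move: xP; rewrite !inE; lia.
have mx : m <= x by move: xP; rewrite !inE; lia.
split; last 2 first.
- by lia.
- have big y : S y -> 0 < y -> m <= y.
    by case=> [Sy y0|/= cy _]; [exact: span3_ge|lia].
  by move=> y z Sy Sz y0 z0 xE; have := big y Sy y0; have := big z Sz z0; lia.
left; move: xP; rewrite !inE => /or3P[]/eqP->.
- by exists 1, 0, 0; lia.
- by exists 0, 1, 0; lia.
- by exists 0, 1, 1; lia.
Qed.

Lemma span3_irreducible (x : nat) : span3 m (m.*2 - d) x ->
  irreducibles S x -> x \in [:: m; m.*2 - d; (m.*2 - d).+1].
Proof.
move=> Mx [_ x0 irr]; have [x00|//|[y [z [My Mz y0 z0 xE]]]] :=
  span3_cases (m := m) (g := m.*2 - d) ltac:(lia) ltac:(lia) Mx; first by lia.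
by case: (irr y z (or_introl My) (or_introl Mz) y0 z0).
Qed.

Lemma left_generatorsE : minimal_generators S `&` left_part S =
  [set` [:: m; m.*2 - d; (m.*2 - d).+1]].
Proof.
rewrite minimal_generatorsE; last exact: S_submonoid.
apply/seteqP; split=> [x [irr [Sx]]|x xP].
  rewrite conductorE => xc; apply: span3_irreducible => //.
  by case: Sx => // /=; lia.
split; first exact: generators_irreducible.
split; first by have [] := generators_irreducible xP.
by move: xP; rewrite /= conductorE !inE; lia.
Qed.

Lemma left_partE :
  left_part S = [set` [seq level_value m d i | i <- left_index k]].
Proof.
apply/seteqP; split=> x /=; rewrite -(left_part_index x k_gt0 dE mE);
  rewrite /left_part /= conductorE -/c.
  by move=> [[//|/= cx] xc]; lia.
by move=> [Mx xc]; split=> //; left.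
Qed.

(* A decomposable element of [I_q] is a sum of two elements that are at least
   m, hence smaller than c. *)
Lemma DqE : Dq S = [set` [seq level_value m d i | i <- Dq_index k]].
Proof.
rewrite /Dq minimal_generatorsE; last exact: S_submonoid.
apply/seteqP; split=> x /=; rewrite -(Dq_part_index x k_gt0 dE mE);
  rewrite /Iq /= conductorE multiplicityE -/c.
  move=> [xI red]; split=> //; apply: contrapT => nMx; apply: red.
  split; [by right; case/andP: xI|by lia|].
  move=> y z Sy Sz y0 z0 xE; apply: nMx.
  have big u : S u -> 0 < u -> m <= u.
    by case=> [Su u0|/= cu _]; [exact: span3_ge|lia].
  have ym := big y Sy y0; have zm := big z Sz z0.
  rewrite xE; apply: (span3_submonoid _ _).2.
    by case: Sy => // /= cy; lia.
  by case: Sz => // /= cz; lia.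
move=> [Mx xI]; split=> // irr.
(* An irreducible element of the span is m, g or g+1, all below c. *)
by have := span3_irreducible Mx irr; rewrite !inE; lia.
Qed.

Lemma card_left_generators : card (minimal_generators S `&` left_part S) = 3.
Proof. by rewrite left_generatorsE card_set_seq //= !inE; lia. Qed.

Lemma card_left_part :
  6 * card (left_part S) = 2 * (k * k.+1 * k.+2) + 3 * (k * (k + 3)).
Proof.
rewrite left_partE card_set_seq; last exact: left_values_uniq k_gt0 dE mE.
by rewrite size_map size_left_index.
Qed.

Lemma card_Dq : 2 * card (Dq S) = (k + 2) * (k + 3).
Proof.
rewrite DqE card_set_seq; last exact: Dq_values_uniq k_gt0 dE mE.
by rewrite size_map size_Dq_index.
Qed.

Local Open Scope ring_scope.

Lemma qnumE : qnum S = k.*2%:Z.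
Proof.
rewrite /qnum conductorE multiplicityE; apply: Num.Theory.ceil_def.
have m0 : (0 < m%:R :> rat) by rewrite ltr0n; lia.
(* The claim becomes (2k-1)m < 2km - t <= 2km, which holds as t < m. *)
rewrite ltr_pdivlMr // ler_pdivrMr //.
have -> : k.*2%:Z - 1 = (k.*2.-1)%:Z by lia.
rewrite !pmulrn -!rmorphM /= !ltr_int !ler_int /c.
by apply/andP; split; nia.
Qed.

Lemma rhoE : rho S = t%:Z.
Proof. by rewrite /rho qnumE conductorE multiplicityE /c; nia. Qed.

(** 3|L| - 2k|D_q| = k(k+1)(k+2) + 3k(k+3)/2 - k(k+2)(k+3) = k(1-k)/2; doubling stays within the
    integers. *)
Lemma EliahouE : 2 * Eliahou S = k%:Z * (1 - k%:Z) + 2 * t%:Z.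
Proof.
rewrite /Eliahou card_left_generators qnumE rhoE.
by have := card_left_part; have := card_Dq; nia.
Qed.

End Invariants.

Local Open Scope ring_scope.

Theorem theorem4p7 (p tau : nat) (p_gt0 : (0 < p)%N) (p_even : ~~ odd p) :
  Eliahou (Sptau p tau) = Eliahou (Sp p) + rho (Sptau p tau) /\
  (Eliahou (Sp p) + rho (Sptau p tau))%:~R =
    p%:R / 4 * (1 - p%:R / 2) + tau%:R :> rat.
Proof.
have [k k0 ->] : exists2 k, (0 < k)%N & p = k.*2 by exists p./2; lia.
rewrite /Sp (SptauE (t := tau) k0 erefl erefl) (SptauE (t := 0) k0 erefl erefl).
rewrite rhoE //.
have E := EliahouE (t := tau) k0 erefl erefl.
have E0 := EliahouE (t := 0) k0 erefl erefl.
split; first by lia.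
move: E0; set e := Eliahou _ => E0; rewrite intrD.
(* With p = 2k, (p/4)(1 - p/2) is k(1-k)/2. *)
have : (2 * e)%:~R = k%:R * (1 - k%:R) :> rat.
  by rewrite E0 mulr0 addr0 intrM intrB.
rewrite -muln2 natrM intrM pmulrn => E0'.
by lra.
Qed.
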